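(* Let $\Bbbk$ be a field of characteristic zero, $U,U'$ finite-dimensional $\Bbbk$-vector spaces, and let $W\subset\mathcal Z^2(U)$ and $W'\subset\mathcal Z^2(U')$ be finite-dimensional graded submodules that are level of the same degree $d$. Then $\mathfrak g_W=M(U)/W^\perp$ and $\mathfrak g_{W'}=M(U')/W'^\perp$ are isomorphic, abstractly or as graded Lie algebras, if and only if there is a linear isomorphism $P:U\to U'$ such that $P^*W'_d=W_d$.
   Context: $M(U)=\operatorname{Lie}(U)/\operatorname{Lie}(U)''$ is the free metabelian Lie algebra, graded with $U$ in degree one; $B(U)=M(U)'$ is an abelian ideal and a graded module over $R=\operatorname{Sym}(U)$ via $u\cdot b=[u,b]$, with $[u,v]$ ($u,v\in U$) in internal degree $0$. $\mathcal Z^2(U)=B(U)^\circ=\bigoplus_rB(U)_r^*$ is its restricted graded dual with contraction action $\langle b,p\circ\Phi\rangle=\langle pb,\Phi\rangle$, $p\in R$. A graded submodule is a graded subspace stable under this action; $W_r$ is its degree-$r$ part; $W^\perp\subset B(U)$ is the annihilator of $W$. $W$ is level of degree $d$ if $W_d\ne0$, $W_r=0$ for $r>d$, and $W=R\circ W_d$. A linear isomorphism $P:U\to U'$ induces $B(U)\to B(U')$ and its degreewise transpose $P^*:\mathcal Z^2(U')\to\mathcal Z^2(U)$. ''Abstractly or graded'' means the criterion holds for both notions of isomorphism. *)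

(* Defs.v *)
From HB Require Import structures.
From mathcomp Require Import all_boot all_algebra.
From mathcomp Require Import boolp classical_sets functions.
From mathcomp Require Import ssrcomplements mpoly.

Set Implicit Arguments.
Unset Strict Implicit.
Unset Printing Implicit Defensive.

Import GRing.Theory.
Local Open Scope ring_scope.
Local Open Scope classical_set_scope.
Local Open Scope quotient_scope.

Section Span.
Variables (k : fieldType) (V : lmodType k).

Definition lspan (S : set V) : set V :=
  [set x | exists s : seq (k * V),
     (forall p, p \in s -> S p.2) /\ x = \sum_(p <- s) p.1 *: p.2].

Definition subspace (S : set V) : Prop :=
  S 0 /\ forall (a : k) x y, S x -> S y -> S (a *: x + y).

Lemma lspan_sub (S : set V) : S `<=` lspan S.
Proof.
move=> x Sx; exists [:: (1, x)]; split; last by rewrite big_seq1 scale1r.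
by move=> p; rewrite inE => /eqP ->.
Qed.

Lemma lspan_subspace (S : set V) : subspace (lspan S).
Proof.
split; first by exists [::]; rewrite big_nil.
move=> a _ _ [s [Ss ->]] [t [St ->]].
exists ([seq (a * p.1, p.2) | p <- s] ++ t); split.
  by move=> p; rewrite mem_cat => /orP[/mapP[q qs ->]|/St//]; exact: Ss qs.
rewrite big_cat big_map scaler_sumr; congr (_ + _).
by apply: eq_bigr => p _; rewrite scalerA.
Qed.

Lemma lspan_min (S T : set V) : subspace T -> S `<=` T -> lspan S `<=` T.
Proof.
move=> [T0 TP] ST _ [s [Ss ->]]; elim: s Ss => [|p s IHs] Ss.
  by rewrite big_nil.
rewrite big_cons; apply: TP; first by apply/ST/Ss; rewrite mem_head.
by apply: IHs => q qs; apply: Ss; rewrite inE qs orbT.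
Qed.

End Span.

HB.mixin Record isLieAlgebra (k : fieldType) L of GRing.Lmodule k L := {
  lbr : L -> L -> L;
  lbr_linearl : forall (a : k) x y z,
    lbr (a *: x + y) z = a *: lbr x z + lbr y z;
  lbr_linearr : forall (a : k) x y z,
    lbr x (a *: y + z) = a *: lbr x y + lbr x z;
  lbrxx : forall x, lbr x x = 0;
  lbr_jacobi : forall x y z,
    lbr x (lbr y z) + lbr y (lbr z x) + lbr z (lbr x y) = 0
}.

#[short(type="lieAlgType")]
HB.structure Definition LieAlgebra (k : fieldType) :=
  { L of GRing.Lmodule k L & isLieAlgebra k L }.

Notation "[lie x , y ]" := (lbr x y) (at level 0, format "[lie  x ,  y ]").

Section LieTheory.
Variables (k : fieldType) (L : lieAlgType k).
Implicit Types x y z : L.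

Lemma lbrDl x y z : [lie x + y, z] = [lie x, z] + [lie y, z].
Proof. by rewrite -[x]scale1r lbr_linearl !scale1r. Qed.
Lemma lbrDr x y z : [lie x, y + z] = [lie x, y] + [lie x, z].
Proof. by rewrite -[y]scale1r lbr_linearr !scale1r. Qed.
Lemma lbr0l x : [lie 0, x] = 0.
Proof. by apply: (addrI [lie 0, x]); rewrite -lbrDl !addr0. Qed.
Lemma lbr0r x : [lie x, 0] = 0.
Proof. by apply: (addrI [lie x, 0]); rewrite -lbrDr !addr0. Qed.
Lemma lbrZl (a : k) x y : [lie a *: x, y] = a *: [lie x, y].
Proof. by rewrite -[a *: x]addr0 lbr_linearl lbr0l addr0. Qed.
Lemma lbrZr (a : k) x y : [lie x, a *: y] = a *: [lie x, y].
Proof. by rewrite -[a *: y]addr0 lbr_linearr lbr0r addr0. Qed.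
Lemma lbrNl x y : [lie - x, y] = - [lie x, y].
Proof. by rewrite -scaleN1r lbrZl scaleN1r. Qed.
Lemma lbrNr x y : [lie x, - y] = - [lie x, y].
Proof. by rewrite -scaleN1r lbrZr scaleN1r. Qed.
Lemma lbrC x y : [lie x, y] = - [lie y, x].
Proof.
apply/eqP; rewrite -addr_eq0; apply/eqP.
by have := lbrxx (x + y); rewrite lbrDl !lbrDr !lbrxx addr0 add0r.
Qed.
Lemma lbr_leibniz x y z :
  [lie x, [lie y, z]] = [lie [lie x, y], z] + [lie y, [lie x, z]].
Proof.
have := lbr_jacobi x y z; rewrite (lbrC z x) lbrNr (lbrC z [lie x, y]).
by rewrite -addrA -opprD => /subr0_eq ->; rewrite addrC.
Qed.

Definition lie_comm (S T : set L) : set L :=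
  lspan [set z | exists x y, [/\ S x, T y & z = [lie x, y]]].

End LieTheory.

Definition derived (k : fieldType) (L : lieAlgType k) : set L :=
  lie_comm setT setT.

Arguments derived {k} L _.

Definition derived2 (k : fieldType) (L : lieAlgType k) : set L :=
  lie_comm (derived L) (derived L).

Arguments derived2 {k} L _.

Definition lie_morphism (k : fieldType) (L L' : lieAlgType k)
    (f : L -> L') : Prop :=
  linear f /\ {morph f : x y / [lie x, y] >-> [lie x, y]}.

Definition lie_isomorphic (k : fieldType) (L L' : lieAlgType k) : Prop :=
  exists f : L -> L', lie_morphism f /\ bijective f.

Definition graded_lie_isomorphic (k : fieldType) (L L' : lieAlgType k)
    (G : nat -> set L) (G' : nat -> set L') : Prop :=
  exists f : L -> L',
    [/\ lie_morphism f, bijective f & forall n, f @` G n = G' n].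

Record lieIdeal (k : fieldType) (L : lieAlgType k) := LieIdeal {
  ideal_set :> L -> Prop;
  ideal_subspace : subspace ideal_set;
  ideal_lbr : forall x y, ideal_set y -> ideal_set [lie x, y]
}.

Section Quotient.
Variables (k : fieldType) (L : lieAlgType k) (I : lieIdeal L).

Definition ideal_pred : L -> bool := fun x => x \in (ideal_set I : set L).

Lemma ideal_predP x : reflect (I x) (ideal_pred x).
Proof. by apply: (iffP idP); rewrite /ideal_pred inE. Qed.

Fact ideal_zmod_closed : zmod_closed ideal_pred.
Proof.
have [I0 IP] := ideal_subspace I.
split; first exact/ideal_predP.
move=> x y /ideal_predP Ix /ideal_predP Iy; apply/ideal_predP.
by rewrite addrC -scaleN1r; apply: IP.
Qed.
HB.instance Definition _ :=
  GRing.isZmodClosed.Build L ideal_pred ideal_zmod_closed.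

Definition ideal_zmod : zmodClosed L := GRing.ZmodClosed.clone L ideal_pred _.

Definition lquot : Type := Quotient.quot ideal_zmod.
HB.instance Definition _ := GRing.Zmodule.on lquot.

Definition lpi (x : L) : lquot := \pi_(Quotient.quot ideal_zmod) x.
Definition lrepr (x : lquot) : L := repr (x : Quotient.quot ideal_zmod).

Lemma lreprK x : lpi (lrepr x) = x.
Proof. exact: reprK. Qed.

Lemma lpi_eq x y : lpi x = lpi y <-> I (x - y).
Proof.
split; last by move=> Ixy; apply/eqP; rewrite /lpi eqmodE; apply/ideal_predP.
by move/eqP; rewrite /lpi eqmodE => /ideal_predP.
Qed.

Lemma lpiD x y : lpi (x + y) = lpi x + lpi y.
Proof. exact: (raddfD \pi_(Quotient.quot ideal_zmod)). Qed.

Definition lquot_scale (a : k) (x : lquot) : lquot := lpi (a *: lrepr x).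
Definition lquot_lbr (x y : lquot) : lquot := lpi [lie lrepr x, lrepr y].

Lemma lrepr_lpi x : I (lrepr (lpi x) - x).
Proof. by apply/lpi_eq; rewrite lreprK. Qed.

Lemma idealZ (a : k) x : I x -> I (a *: x).
Proof.
by have [I0 IP] := ideal_subspace I => Ix; rewrite -[_ *: _]addr0; apply: IP.
Qed.

Lemma idealD x y : I x -> I y -> I (x + y).
Proof.
by have [I0 IP] := ideal_subspace I => Ix Iy; rewrite -[x]scale1r; apply: IP.
Qed.

Lemma lquot_scale_pi a x : lquot_scale a (lpi x) = lpi (a *: x).
Proof. by apply/lpi_eq; rewrite -scalerBr; apply/idealZ/lrepr_lpi. Qed.

Lemma lquot_lbr_pi x y : lquot_lbr (lpi x) (lpi y) = lpi [lie x, y].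
Proof.
apply/lpi_eq.
set x' := lrepr _; set y' := lrepr _.
have -> : [lie x', y'] - [lie x, y] =
    - [lie y', x' - x] + [lie x, y' - y].
  by rewrite (lbrC y') opprK lbrDl lbrDr lbrNl lbrNr addrA addrNK.
apply: idealD; last exact/ideal_lbr/lrepr_lpi.
by rewrite -scaleN1r; apply/idealZ/ideal_lbr/lrepr_lpi.
Qed.

Fact lquot_scalerA a b x :
  lquot_scale a (lquot_scale b x) = lquot_scale (a * b) x.
Proof. by rewrite -[x]lreprK !lquot_scale_pi scalerA. Qed.
Fact lquot_scale1r : left_id 1 lquot_scale.
Proof. by move=> x; rewrite -[x]lreprK !lquot_scale_pi scale1r. Qed.
Fact lquot_scalerDr : right_distributive lquot_scale +%R.
Proof.
by move=> a x y; rewrite -[x]lreprK -[y]lreprK -lpiD !lquot_scale_pi -lpiD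
  scalerDr.
Qed.
Fact lquot_scalerDl x : {morph lquot_scale^~ x : a b / a + b}.
Proof. by move=> a b /=; rewrite -[x]lreprK !lquot_scale_pi -lpiD scalerDl. Qed.

HB.instance Definition _ := GRing.Zmodule_isLmodule.Build k lquot
  lquot_scalerA lquot_scale1r lquot_scalerDr lquot_scalerDl.

Lemma lpi_linear : linear lpi.
Proof. by move=> a x y; rewrite lpiD -[RHS]/(lquot_scale a _ + _)
  lquot_scale_pi. Qed.
HB.instance Definition _ := GRing.isLinear.Build k L lquot *:%R lpi lpi_linear.

Fact lquot_linearl (a : k) x y z :
  lquot_lbr (a *: x + y) z = a *: lquot_lbr x z + lquot_lbr y z.
Proof.
by rewrite -[x]lreprK -[y]lreprK -[z]lreprK -linearP !lquot_lbr_pi -linearP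
  lbr_linearl.
Qed.
Fact lquot_linearr (a : k) x y z :
  lquot_lbr x (a *: y + z) = a *: lquot_lbr x y + lquot_lbr x z.
Proof.
by rewrite -[x]lreprK -[y]lreprK -[z]lreprK -linearP !lquot_lbr_pi -linearP
  lbr_linearr.
Qed.
Fact lquot_lbrxx x : lquot_lbr x x = 0.
Proof. by rewrite -[x]lreprK lquot_lbr_pi lbrxx linear0. Qed.
Fact lquot_jacobi x y z :
  lquot_lbr x (lquot_lbr y z) + lquot_lbr y (lquot_lbr z x)
    + lquot_lbr z (lquot_lbr x y) = 0.
Proof.
by rewrite -[x]lreprK -[y]lreprK -[z]lreprK !lquot_lbr_pi -!linearD lbr_jacobi
  linear0.
Qed.
HB.instance Definition _ := isLieAlgebra.Build k lquot
  lquot_linearl lquot_linearr lquot_lbrxx lquot_jacobi.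

Lemma lpi_lbr : {morph lpi : x y / [lie x, y] >-> [lie x, y]}.
Proof. by move=> x y; rewrite -lquot_lbr_pi. Qed.

End Quotient.

Arguments lpi {k L} I x.
Arguments lrepr {k L} I x.

Section Derived.
Variables (k : fieldType) (L : lieAlgType k).

Lemma derived_lbr (x y : L) : derived L [lie x, y].
Proof. by apply: lspan_sub; exists x, y. Qed.

Fact derived2_lbr (x y : L) : derived2 L y -> derived2 L [lie x, y].
Proof.
have [S0 SP] := lspan_subspace
  [set z : L | exists x y, [/\ derived L x, derived L y & z = [lie x, y]]].
apply: (@lspan_min _ _ _ [set y | derived2 L [lie x, y]]) => /=.
  split=> /= [|a u v Hu Hv]; first by rewrite lbr0r.
  by rewrite lbr_linearr; apply: SP.
move=> _ [u [v [Du Dv ->]]] /=; rewrite lbr_leibniz -[X in X + _]scale1r.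
by apply: SP; apply: lspan_sub; [exists [lie x, u], v | exists u, [lie x, v]];
  split=> //; apply: derived_lbr.
Qed.

Definition derived2_ideal : lieIdeal L :=
  LieIdeal (lspan_subspace _) derived2_lbr.

End Derived.

(* The free Lie algebra on the vector space U: formal nonassociative        *)
(* k-linear expressions in elements of U, modulo the Lie algebra axioms and *)
(* the linearity of the inclusion of U (universal property: freeLie_lift).  *)
Section FreeLie.
Variables (k : fieldType) (U : lmodType k).

Inductive lterm : Type :=
  | TGen of U
  | TZero
  | TAdd of lterm & lterm
  | TScale of k & lterm
  | TLbr of lterm & lterm.

Inductive lterm_eq : lterm -> lterm -> Prop :=
  | te_refl x : lterm_eq x x
  | te_sym x y : lterm_eq x y -> lterm_eq y x
  | te_trans y x z : lterm_eq x y -> lterm_eq y z -> lterm_eq x z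
  | te_add x x' y y' :
      lterm_eq x x' -> lterm_eq y y' -> lterm_eq (TAdd x y) (TAdd x' y')
  | te_scale a x x' : lterm_eq x x' -> lterm_eq (TScale a x) (TScale a x')
  | te_lbr x x' y y' :
      lterm_eq x x' -> lterm_eq y y' -> lterm_eq (TLbr x y) (TLbr x' y')
  | te_addA x y z : lterm_eq (TAdd x (TAdd y z)) (TAdd (TAdd x y) z)
  | te_addC x y : lterm_eq (TAdd x y) (TAdd y x)
  | te_add0 x : lterm_eq (TAdd TZero x) x
  | te_addN x : lterm_eq (TAdd (TScale (-1) x) x) TZero
  | te_scaleA a b x :
      lterm_eq (TScale a (TScale b x)) (TScale (a * b) x)
  | te_scale1 x : lterm_eq (TScale 1 x) x
  | te_scaleDr a x y :
      lterm_eq (TScale a (TAdd x y)) (TAdd (TScale a x) (TScale a y))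
  | te_scaleDl a b x :
      lterm_eq (TScale (a + b) x) (TAdd (TScale a x) (TScale b x))
  | te_lbr_linearl a x y z :
      lterm_eq (TLbr (TAdd (TScale a x) y) z)
               (TAdd (TScale a (TLbr x z)) (TLbr y z))
  | te_lbr_linearr a x y z :
      lterm_eq (TLbr x (TAdd (TScale a y) z))
               (TAdd (TScale a (TLbr x y)) (TLbr x z))
  | te_lbrxx x : lterm_eq (TLbr x x) TZero
  | te_jacobi x y z :
      lterm_eq (TAdd (TAdd (TLbr x (TLbr y z)) (TLbr y (TLbr z x)))
                     (TLbr z (TLbr x y))) TZero
  | te_gen a u v :
      lterm_eq (TGen (a *: u + v)) (TAdd (TScale a (TGen u)) (TGen v)).

HB.instance Definition _ := gen_eqMixin lterm.
HB.instance Definition _ := gen_choiceMixin lterm.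

Definition lterm_eqb (x y : lterm) : bool := `[< lterm_eq x y >].

Fact lterm_eqb_equiv : equiv_class_of lterm_eqb.
Proof.
split=> [x|x y|y x z]; first by apply/asboolP; exact: te_refl.
  by apply/asboolP/asboolP; exact: te_sym.
by move=> /asboolP xy /asboolP yz; apply/asboolP; exact: te_trans xy yz.
Qed.
Canonical lterm_equiv := EquivRelPack lterm_eqb_equiv.
Canonical lterm_encModRel := defaultEncModRel lterm_eqb.

Definition freeLie : Type := {eq_quot lterm_eqb}.
HB.instance Definition _ := Choice.on freeLie.

Definition fpi (t : lterm) : freeLie := \pi_({eq_quot lterm_eqb}) t.
Definition frepr (x : freeLie) : lterm := repr (x : {eq_quot lterm_eqb}).

Lemma freprK x : fpi (frepr x) = x.
Proof. exact: reprK. Qed.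

Lemma fpi_eq s t : fpi s = fpi t <-> lterm_eq s t.
Proof.
split; last by move=> st; apply/eqP; rewrite /fpi eqmodE; apply/asboolP.
by move/eqP; rewrite /fpi eqmodE => /asboolP.
Qed.

Lemma frepr_fpi t : lterm_eq (frepr (fpi t)) t.
Proof. by apply/fpi_eq; rewrite freprK. Qed.

Definition fadd (x y : freeLie) : freeLie := fpi (TAdd (frepr x) (frepr y)).
Definition fscale (a : k) (x : freeLie) : freeLie := fpi (TScale a (frepr x)).
Definition flbr (x y : freeLie) : freeLie := fpi (TLbr (frepr x) (frepr y)).

Lemma fadd_pi s t : fadd (fpi s) (fpi t) = fpi (TAdd s t).
Proof. by apply/fpi_eq; apply: te_add; exact: frepr_fpi. Qed.
Lemma fscale_pi a s : fscale a (fpi s) = fpi (TScale a s).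
Proof. by apply/fpi_eq; apply: te_scale; exact: frepr_fpi. Qed.
Lemma flbr_pi s t : flbr (fpi s) (fpi t) = fpi (TLbr s t).
Proof. by apply/fpi_eq; apply: te_lbr; exact: frepr_fpi. Qed.

Let piE := (fadd_pi, fscale_pi, flbr_pi).

Fact faddA : associative fadd.
Proof.
move=> x y z; rewrite -[x]freprK -[y]freprK -[z]freprK !piE.
by apply/fpi_eq; exact: te_addA.
Qed.
Fact faddC : commutative fadd.
Proof.
move=> x y; rewrite -[x]freprK -[y]freprK !piE.
by apply/fpi_eq; exact: te_addC.
Qed.
Fact fadd0 : left_id (fpi TZero) fadd.
Proof. by move=> x; rewrite -[x]freprK piE; apply/fpi_eq; exact: te_add0. Qed.
Fact faddN : left_inverse (fpi TZero) (fscale (-1)) fadd.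
Proof. by move=> x; rewrite -[x]freprK !piE; apply/fpi_eq; exact: te_addN. Qed.

HB.instance Definition _ :=
  GRing.isZmodule.Build freeLie faddA faddC fadd0 faddN.

Fact fscaleA a b x : fscale a (fscale b x) = fscale (a * b) x.
Proof. by rewrite -[x]freprK !piE; apply/fpi_eq; exact: te_scaleA. Qed.
Fact fscale1 : left_id 1 fscale.
Proof.
by move=> x; rewrite -[x]freprK !piE; apply/fpi_eq; exact: te_scale1.
Qed.
Fact fscaleDr : right_distributive fscale +%R.
Proof.
move=> a x y; rewrite -[x]freprK -[y]freprK /GRing.add /= !piE.
by apply/fpi_eq; exact: te_scaleDr.
Qed.
Fact fscaleDl x : {morph fscale^~ x : a b / a + b}.
Proof.
move=> a b; rewrite -[x]freprK [RHS]/GRing.add /= !piE.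
by apply/fpi_eq; exact: te_scaleDl.
Qed.

HB.instance Definition _ := GRing.Zmodule_isLmodule.Build k freeLie
  fscaleA fscale1 fscaleDr fscaleDl.

Lemma fpi_zero : fpi TZero = 0.
Proof. by []. Qed.
Lemma fpi_add s t : fpi (TAdd s t) = fpi s + fpi t.
Proof. by rewrite -fadd_pi. Qed.
Lemma fpi_scale a s : fpi (TScale a s) = a *: fpi s.
Proof. by rewrite -fscale_pi. Qed.

Fact flbr_linearl (a : k) x y z :
  flbr (a *: x + y) z = a *: flbr x z + flbr y z.
Proof.
rewrite -[x]freprK -[y]freprK -[z]freprK -fpi_scale -fpi_add !flbr_pi.
by rewrite -fpi_scale -fpi_add; apply/fpi_eq; exact: te_lbr_linearl.
Qed.
Fact flbr_linearr (a : k) x y z :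
  flbr x (a *: y + z) = a *: flbr x y + flbr x z.
Proof.
rewrite -[x]freprK -[y]freprK -[z]freprK -fpi_scale -fpi_add !flbr_pi.
by rewrite -fpi_scale -fpi_add; apply/fpi_eq; exact: te_lbr_linearr.
Qed.
Fact flbrxx x : flbr x x = 0.
Proof. by rewrite -[x]freprK flbr_pi; apply/fpi_eq; exact: te_lbrxx. Qed.
Fact flbr_jacobi x y z :
  flbr x (flbr y z) + flbr y (flbr z x) + flbr z (flbr x y) = 0.
Proof.
rewrite -[x]freprK -[y]freprK -[z]freprK !flbr_pi -!fpi_add.
by apply/fpi_eq; exact: te_jacobi.
Qed.
HB.instance Definition _ := isLieAlgebra.Build k freeLie
  flbr_linearl flbr_linearr flbrxx flbr_jacobi.

Lemma fpi_lbr s t : fpi (TLbr s t) = [lie fpi s, fpi t].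
Proof. by rewrite -flbr_pi. Qed.

Definition fgen (u : U) : freeLie := fpi (TGen u).

Lemma fgen_linear : linear fgen.
Proof.
by move=> a u v; rewrite /fgen -fpi_scale -fpi_add; apply/fpi_eq; exact: te_gen.
Qed.
HB.instance Definition _ := GRing.isLinear.Build k U freeLie *:%R fgen
  fgen_linear.

Lemma freeLie_ind (P : freeLie -> Prop) :
  (forall u, P (fgen u)) -> P 0 ->
  (forall x y, P x -> P y -> P (x + y)) ->
  (forall a x, P x -> P (a *: x)) ->
  (forall x y, P x -> P y -> P [lie x, y]) -> forall x, P x.
Proof.
move=> Pg P0 PD PZ PB x; rewrite -[x]freprK.
elim: (frepr x) => [u||s Ps t Pt|a s Ps|s Ps t Pt].
- exact: Pg.
- by rewrite fpi_zero.
- by rewrite fpi_add; exact: PD.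
- by rewrite fpi_scale; exact: PZ.
- by rewrite fpi_lbr; exact: PB.
Qed.

Inductive lie_mono : nat -> freeLie -> Prop :=
  | lie_mono_gen u : lie_mono 1 (fgen u)
  | lie_mono_lbr m n x y :
      lie_mono m x -> lie_mono n y -> lie_mono (m + n) [lie x, y].

Definition freeLie_deg (n : nat) : set freeLie := lspan (lie_mono n).

Section Lift.
Variables (L : lieAlgType k) (f : U -> L).
Hypothesis f_linear : linear f.

Fixpoint lterm_eval (t : lterm) : L :=
  match t with
  | TGen u => f u
  | TZero => 0
  | TAdd s t => lterm_eval s + lterm_eval t
  | TScale a s => a *: lterm_eval s
  | TLbr s t => [lie lterm_eval s, lterm_eval t]
  end.

Definition freeLie_lift (x : freeLie) : L := lterm_eval (frepr x).

Lemma lterm_eval_eq s t : lterm_eq s t -> lterm_eval s = lterm_eval t.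
Proof.
elim=> //=.
- by move=> y x z _ -> _ ->.
- by move=> x x' y y' _ -> _ ->.
- by move=> a x x' _ ->.
- by move=> x x' y y' _ -> _ ->.
- by move=> x y z; rewrite addrA.
- by move=> x y; rewrite addrC.
- by move=> x; rewrite add0r.
- by move=> x; rewrite scaleN1r addNr.
- by move=> a b x; rewrite scalerA.
- by move=> x; rewrite scale1r.
- by move=> a x y; rewrite scalerDr.
- by move=> a b x; rewrite scalerDl.
- by move=> a x y z; rewrite lbr_linearl.
- by move=> a x y z; rewrite lbr_linearr.
- by move=> x; rewrite lbrxx.
- by move=> x y z; rewrite lbr_jacobi.
Qed.

Lemma freeLie_lift_pi t : freeLie_lift (fpi t) = lterm_eval t.
Proof. exact/lterm_eval_eq/frepr_fpi. Qed.

Lemma freeLie_lift_gen u : freeLie_lift (fgen u) = f u.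
Proof. exact: freeLie_lift_pi. Qed.

Lemma freeLie_lift_morphism : lie_morphism freeLie_lift.
Proof.
split=> [a x y|x y]; rewrite -[x]freprK -[y]freprK.
  by rewrite -fpi_scale -fpi_add !freeLie_lift_pi.
by rewrite -fpi_lbr !freeLie_lift_pi.
Qed.

Lemma freeLie_lift_unique (g : freeLie -> L) :
  lie_morphism g -> g \o fgen =1 f -> g =1 freeLie_lift.
Proof.
move=> [gl gb] gf x.
have [hl hb] := freeLie_lift_morphism.
have lin0 (h : freeLie -> L) : linear h -> h 0 = 0.
  by move=> hh; have := hh (-1) 0 0; rewrite !scaleN1r oppr0 addr0 addNr.
have linD (h : freeLie -> L) y z : linear h -> h (y + z) = h y + h z.
  by move=> hh; have := hh 1 y z; rewrite !scale1r.
have linZ (h : freeLie -> L) a y : linear h -> h (a *: y) = a *: h y.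
  by move=> hh; have := hh a y 0; rewrite !addr0 (lin0 _ hh) addr0.
elim/freeLie_ind: x => [u||y z IHy IHz|a y IHy|y z IHy IHz].
- by rewrite freeLie_lift_gen -gf.
- by rewrite !lin0.
- by rewrite !linD // IHy IHz.
- by rewrite !linZ // IHy.
- by rewrite gb hb IHy IHz.
Qed.

End Lift.

End FreeLie.

Arguments fgen {k U} u.

Section FreeMetabelian.
Variables (k : fieldType) (U : vectType k).

Definition metab : Type := lquot (derived2_ideal (freeLie U)).
HB.instance Definition _ := LieAlgebra.on metab.

Definition Mpi (x : freeLie U) : metab := lpi (derived2_ideal (freeLie U)) x.
HB.instance Definition _ := GRing.Linear.copy Mpi
  (lpi (derived2_ideal (freeLie U))).
Definition Mgen (u : U) : metab := Mpi (fgen u).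
HB.instance Definition _ := GRing.Linear.copy Mgen (Mpi \o fgen).

Definition Mdeg (n : nat) : set metab := Mpi @` freeLie_deg n.

Lemma Mpi_lbr : {morph Mpi : x y / [lie x, y] >-> [lie x, y]}.
Proof. exact: lpi_lbr. Qed.

Definition in_derived : metab -> bool := fun x => x \in derived metab.

Lemma in_derivedP x : reflect (derived metab x) (in_derived x).
Proof. by apply: (iffP idP); rewrite /in_derived inE. Qed.

Fact in_derived_submod_closed : submod_closed in_derived.
Proof.
have [D0 DP] := lspan_subspace
  [set z : metab | exists x y, [/\ setT x, setT y & z = [lie x, y]]].
split; first exact/in_derivedP.
by move=> a x y /in_derivedP Dx /in_derivedP Dy; apply/in_derivedP/DP.
Qed.
HB.instance Definition _ :=
  GRing.isSubmodClosed.Build k metab in_derived in_derived_submod_closed.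

Record Bmod : Type := MkB { Bval : metab; BvalP : in_derived Bval }.
HB.instance Definition _ := [isSub for Bval].
HB.instance Definition _ := [Choice of Bmod by <:].
HB.instance Definition _ := [SubChoice_isSubLmodule of Bmod by <:].

Lemma in_derived_lbr (x y : metab) : in_derived [lie x, y].
Proof. exact/in_derivedP/derived_lbr. Qed.

Lemma metab_decomp (x : metab) : exists u b, x = Mgen u + Bval b.
Proof.
have [y ->] : exists y, x = Mpi y by exists (lrepr _ x); rewrite [RHS]lreprK.
elim/freeLie_ind: y => [u||y z [u [b Ey]] [v [c Ez]]|a y [u [b Ey]]|y z _ _].
- by exists u, 0; rewrite addr0.
- by exists 0, 0; rewrite !linear0 addr0.
- by exists (u + v), (b + c); rewrite !linearD /= Ey Ez addrACA.
- by exists (a *: u), (a *: b); rewrite !linearZ /= Ey scalerDr.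
- exists 0, (MkB (in_derived_lbr (Mpi y) (Mpi z))).
  by rewrite linear0 add0r /= Mpi_lbr.
Qed.

Lemma derived_abelian (x y : metab) :
  derived metab x -> derived metab y -> [lie x, y] = 0.
Proof.
have lift z :
    derived metab z -> exists2 z0, derived (freeLie U) z0 & z = Mpi z0.
  have [S0 SP] := lspan_subspace [set z : freeLie U |
    exists x y, [/\ setT x, setT y & z = [lie x, y]]].
  apply: (@lspan_min _ _ _
    [set z | exists2 z0, derived (freeLie U) z0 & z = Mpi z0]).
    split=> [|a _ _ [u Du ->] [v Dv ->]] /=; first by exists 0; rewrite ?linear0.
    by exists (a *: u + v); [exact: SP | rewrite linearP].
  move=> _ [u [v [_ _ ->]]]; exists [lie lrepr _ u, lrepr _ v].
    exact: derived_lbr.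
  by rewrite Mpi_lbr; congr [lie _, _]; rewrite [RHS]lreprK.
move=> /lift[x0 Dx ->] /lift[y0 Dy ->]; rewrite -Mpi_lbr -[RHS](linear0 Mpi).
by apply/lpi_eq; rewrite subr0; apply: lspan_sub; exists x0, y0.
Qed.

Definition adB (u : U) (b : Bmod) : Bmod :=
  MkB (in_derived_lbr (Mgen u) (Bval b)).

Lemma adB_linear u : linear (adB u).
Proof.
by move=> a b c; apply: val_inj; rewrite linearP /= lbr_linearr.
Qed.
HB.instance Definition _ u := GRing.isLinear.Build k Bmod Bmod *:%R (adB u)
  (adB_linear u).

Lemma adBP a u v b : adB (a *: u + v) b = a *: adB u b + adB v b.
Proof. by apply: val_inj; rewrite linearP /= linearP lbr_linearl. Qed.

Lemma adBC u v b : adB u (adB v b) = adB v (adB u b).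
Proof.
apply: val_inj; rewrite /= lbr_leibniz derived_abelian ?add0r //.
  exact: derived_lbr.
exact/in_derivedP/BvalP.
Qed.

(* Sym(U) is realized as the polynomial ring on the vectors e_i of the      *)
(* basis vbasis fullv of U: the monomial m acts on B(U) as the product of   *)
(* the commuting operators (ad e_i)^(m i).                                  *)
Local Notation dimU := (\dim (fullv : {vspace U})).
Local Notation e_ i := ((vbasis (fullv : {vspace U}))`_(i : 'I_dimU)).

Definition mon_act (m : 'X_{1.. dimU}) (b : Bmod) : Bmod :=
  foldr (fun i c => iter (m i) (adB (e_ i)) c) b (enum 'I_dimU).

Definition sym_act (p : {mpoly k[dimU]}) (b : Bmod) : Bmod :=
  \sum_(m <- msupp p) p@_m *: mon_act m b.

Lemma iter_adB_linear u j : linear (iter j (adB u)).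
Proof. by move=> a b c; elim: j => //= j ->; rewrite linearP. Qed.

Lemma mon_act_linear m : linear (mon_act m).
Proof.
move=> a b c; rewrite /mon_act; elim: (enum _) => //= i s ->.
exact: iter_adB_linear.
Qed.
HB.instance Definition _ m := GRing.isLinear.Build k Bmod Bmod *:%R (mon_act m)
  (mon_act_linear m).

Lemma sym_act_linear p : linear (sym_act p).
Proof.
move=> a b c; rewrite /sym_act scaler_sumr -big_split /=.
by apply: eq_bigr => m _; rewrite linearP scalerDr !scalerA mulrC.
Qed.
HB.instance Definition _ p := GRing.isLinear.Build k Bmod Bmod *:%R (sym_act p)
  (sym_act_linear p).

Lemma sym_actE p N b : (msize p <= N)%N ->
  sym_act p b = \sum_(m : 'X_{1..dimU < N}) p@_m *: mon_act m b.
Proof.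
move=> le_pN; set I : subFinType _ := 'X_{1..dimU < N}.
rewrite /sym_act (big_mksub I) ?msupp_uniq //=; first last.
  by move=> x /msize_mdeg_lt /leq_trans; apply.
by rewrite big_rmcond //= => j /memN_msupp_eq0 ->; rewrite scale0r.
Qed.

Lemma sym_actP a p q b :
  sym_act (a *: p + q) b = a *: sym_act p b + sym_act q b.
Proof.
set N := maxn (msize (a *: p + q)) (maxn (msize p) (msize q)).
rewrite !(@sym_actE _ N) ?leq_max ?leqnn ?orbT //.
rewrite scaler_sumr -big_split /=; apply: eq_bigr => m _.
by rewrite mcoeffD mcoeffZ scalerDl scalerA.
Qed.

Lemma sym_act0 b : sym_act 0 b = 0.
Proof. by rewrite /sym_act msupp0 big_nil. Qed.

Lemma sym_act_sum I (r : seq I) (F : I -> {mpoly k[dimU]}) b :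
  sym_act (\sum_(i <- r) F i) b = \sum_(i <- r) sym_act (F i) b.
Proof.
elim: r => [|i r IHr]; first by rewrite !big_nil sym_act0.
by rewrite !big_cons -IHr -[F i]scale1r sym_actP !scale1r.
Qed.

Lemma sym_actZ a p b : sym_act (a *: p) b = a *: sym_act p b.
Proof. by rewrite -[a *: p]addr0 sym_actP sym_act0 addr0. Qed.

Lemma sym_act_mon m b : sym_act 'X_[m] b = mon_act m b.
Proof. by rewrite /sym_act msuppX big_seq1 mcoeffX eqxx scale1r. Qed.

Lemma iter_adBC u v i b : iter i (adB u) (adB v b) = adB v (iter i (adB u) b).
Proof. by elim: i => //= i ->; rewrite adBC. Qed.

Lemma mon_actD m1 m2 b : mon_act (m1 + m2) b = mon_act m1 (mon_act m2 b).
Proof.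
pose F s m c := foldr (fun i c => iter (m i) (adB (e_ i)) c) c s.
rewrite /mon_act -!/(F _ (fun_of_multinom _) _).
have FC s m v c : F s m (adB v c) = adB v (F s m c).
  by rewrite /F; elim: s => //= j t ->; rewrite iter_adBC.
have FCn s m v j c : F s m (iter j (adB v) c) = iter j (adB v) (F s m c).
  by elim: j => //= j IHj; rewrite FC IHj.
elim: (enum _) => //= i s IHs.
by rewrite IHs mnmDE iterD -FCn.
Qed.

(* sym_act is the Sym(U)-module structure on B(U) in which u in U, viewed   *)
(* as the linear form sym_lin u in the variables, acts as b |-> [u, b].     *)
Lemma sym_act1 b : sym_act 1 b = b.
Proof.
rewrite -[1]mpolyX0 sym_act_mon /mon_act.
by elim: (enum _) => //= i s ->; rewrite mnm0E.
Qed.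

Lemma sym_actM p q b : sym_act (p * q) b = sym_act p (sym_act q b).
Proof.
rewrite [p]mpolyE [q]mpolyE mulr_suml !sym_act_sum.
apply: eq_bigr => m1 _; rewrite mulr_sumr !sym_act_sum linear_sum.
apply: eq_bigr => m2 _; rewrite -scalerAl -scalerAr -mpolyXD !sym_actZ.
rewrite !sym_act_mon mon_actD [RHS]linearZ /= sym_actZ sym_act_mon.
by rewrite !scalerA mulrC.
Qed.

Definition sym_lin (u : U) : {mpoly k[dimU]} :=
  \sum_i coord (vbasis (fullv : {vspace U})) i u *: 'X_i.

Lemma mon_actU i b : mon_act U_(i) b = adB (e_ i) b.
Proof.
rewrite /mon_act.
have E s : uniq s -> foldr (fun j c => iter (U_(i)%MM j) (adB (e_ j)) c) b s =
    if i \in s then adB (e_ i) b else b.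
  elim: s => //= j s IHs /andP[js us]; rewrite IHs // mnm1E inE.
  by case: eqVneq => [->|_] //=; rewrite (negPf js).
by rewrite E ?enum_uniq // mem_enum.
Qed.

Lemma sym_act_lin u b : sym_act (sym_lin u) b = adB u b.
Proof.
rewrite sym_act_sum [in RHS](coord_vbasis (memvf u)).
elim/big_rec2: _ => [|i c v _ ->].
  by apply: val_inj; rewrite /= !linear0 lbr0l.
by rewrite sym_actZ sym_act_mon mon_actU adBP.
Qed.

(* B(U) is regraded so that [u, v], u and v in U, has internal degree 0 *)
Definition Bdeg (r : nat) : set Bmod := [set b | Mdeg (r + 2) (Bval b)].

(* The restricted graded dual, the direct sum of the B(U)_r^*, is the space *)
(* of the linear forms on B(U) that vanish on almost all B(U)_r; the        *)
(* summand B(U)_r^* consists of the forms vanishing on the other B(U)_s.    *)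
Definition Z2 : set (Bmod -> k^o) :=
  [set Phi | linear Phi /\
     exists N, forall r b, (N <= r)%N -> Bdeg r b -> Phi b = 0].

Definition Z2deg (r : nat) : set (Bmod -> k^o) :=
  [set Phi | Z2 Phi /\ forall s b, s != r -> Bdeg s b -> Phi b = 0].

Definition contract (p : {mpoly k[dimU]}) (Phi : Bmod -> k^o) : Bmod -> k^o :=
  fun b => Phi (sym_act p b).

Record gsubmod := GSubmod {
  gsub_set :> (Bmod -> k^o) -> Prop;
  gsub_Z2 : forall Phi, gsub_set Phi -> Z2 Phi;
  gsub_subspace : subspace gsub_set;
  gsub_graded : forall Phi, gsub_set Phi ->
    exists N (Psi : 'I_N -> Bmod -> k^o),
      (forall r, gsub_set (Psi r) /\ Z2deg r (Psi r)) /\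
      Phi = \sum_(r < N) Psi r;
  gsub_contract : forall p Phi, gsub_set Phi -> gsub_set (contract p Phi)
}.

Definition gsub_deg (W : gsubmod) (r : nat) : set (Bmod -> k^o) :=
  [set Phi | W Phi /\ Z2deg r Phi].

Definition gsub_findim (W : gsubmod) : Prop :=
  exists s : seq (Bmod -> k^o), gsub_set W = lspan [set Phi | Phi \in s].

Definition level (W : gsubmod) (d : nat) : Prop :=
  [/\ gsub_deg W d <> [set 0],
      forall r, (d < r)%N -> gsub_deg W r = [set 0]
    & gsub_set W =
        lspan [set Psi |
          exists p Phi, gsub_deg W d Phi /\ Psi = contract p Phi]].

Definition annih (W : gsubmod) : set Bmod :=
  [set b | forall Phi, W Phi -> Phi b = 0].

Fact annih_subspace W : subspace (Bval @` annih W).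
Proof.
have lin Phi : W Phi -> linear Phi by move=> /gsub_Z2[].
split.
  exists 0 => // Phi /lin lPhi.
  by have := lPhi (-1) 0 0; rewrite !scaleN1r oppr0 addr0 addNr.
move=> a _ _ [b Wb <-] [c Wc <-]; exists (a *: b + c); last by [].
by move=> Phi WPhi; rewrite lin // Wb // Wc // scaler0 addr0.
Qed.

Fact annih_lbr W x y :
  (Bval @` annih W) y -> (Bval @` annih W) [lie x, y].
Proof.
have [u [c ->]] := metab_decomp x; move=> [b Wb <-].
rewrite lbrDl [X in _ + X]derived_abelian; [|exact/in_derivedP/BvalP..].
rewrite addr0; exists (adB u b) => // Phi WPhi.
rewrite -sym_act_lin; apply: (Wb (contract (sym_lin u) Phi)).
exact: gsub_contract.
Qed.

Definition annih_ideal (W : gsubmod) : lieIdeal metab :=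
  LieIdeal (annih_subspace W) (@annih_lbr W).

Definition lie_of (W : gsubmod) : Type := lquot (annih_ideal W).
HB.instance Definition _ W := LieAlgebra.on (lie_of W).

Definition lie_of_deg (W : gsubmod) (n : nat) : set (lie_of W) :=
  lpi (annih_ideal W) @` Mdeg n.

End FreeMetabelian.

Arguments Mdeg {k} U n _.
Arguments Bdeg {k} U r _.
Arguments Z2 {k} U _.
Arguments Z2deg {k} U r _.
Arguments gsub_deg {k U} W r _.
Arguments annih {k U} W _.
Arguments lie_of_deg {k U} W n _.

Section Functoriality.
Variables (k : fieldType) (U U' : vectType k) (P : {linear U -> U'}).

Definition freeLie_map : freeLie U -> freeLie U' := freeLie_lift (fgen \o P).

Definition metab_map (x : metab U) : metab U' :=
  Mpi (freeLie_map (lrepr _ x)).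

Lemma freeLie_map_morphism : lie_morphism freeLie_map.
Proof. by apply: freeLie_lift_morphism => a u v /=; rewrite !linearP. Qed.

Lemma linear_sub_span (V V' : lmodType k) (f : V -> V')
    (S : set V) (T : set V') :
  linear f -> subspace T -> (forall x, S x -> T (f x)) ->
  forall x, lspan S x -> T (f x).
Proof.
move=> lf [T0 TP] ST; apply: lspan_min => //; split=> /= [|a u v Tu Tv].
  by have := lf (-1) 0 0; rewrite !scaleN1r oppr0 addr0 addNr => ->.
by rewrite lf; apply: TP.
Qed.

Lemma derived_morphism (L L' : lieAlgType k) (f : L -> L') x :
  lie_morphism f -> derived L x -> derived L' (f x).
Proof.
move=> [fl fb]; apply: linear_sub_span => //; first exact: lspan_subspace.
by move=> _ [u [v [_ _ ->]]]; rewrite fb; apply: derived_lbr.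
Qed.

Lemma derived2_morphism (L L' : lieAlgType k) (f : L -> L') x :
  lie_morphism f -> derived2 L x -> derived2 L' (f x).
Proof.
move=> [fl fb]; apply: linear_sub_span => //; first exact: lspan_subspace.
move=> _ [u [v [Du Dv ->]]]; rewrite fb; apply: lspan_sub.
by exists (f u), (f v); split=> //; exact: derived_morphism.
Qed.

Lemma metab_map_pi x : metab_map (Mpi x) = Mpi (freeLie_map x).
Proof.
have [fl fb] := freeLie_map_morphism; apply/lpi_eq.
have flB y : freeLie_map y - freeLie_map x = freeLie_map (y - x).
  by rewrite -scaleN1r addrC -fl scaleN1r addrC.
rewrite flB; apply: derived2_morphism freeLie_map_morphism _.
exact: (lrepr_lpi (derived2_ideal (freeLie U))).
Qed.

Lemma metab_map_gen u : metab_map (Mgen u) = Mgen (P u).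
Proof.
rewrite metab_map_pi [freeLie_map _]freeLie_lift_gen // => a x y /=.
by rewrite !linearP.
Qed.

Lemma metab_map_morphism : lie_morphism metab_map.
Proof.
have [fl fb] := freeLie_map_morphism.
have E (x : metab U) : exists y, x = Mpi y.
  by exists (lrepr _ x); rewrite [RHS]lreprK.
split=> [a x y|x y]; have [[x0 ->] [y0 ->]] := (E x, E y).
  by rewrite -linearP !metab_map_pi fl linearP.
by rewrite -Mpi_lbr !metab_map_pi fb Mpi_lbr.
Qed.

Fact metab_map_derived (b : Bmod U) : in_derived (metab_map (Bval b)).
Proof.
apply/in_derivedP/(derived_morphism metab_map_morphism)/in_derivedP/BvalP.
Qed.

Definition Bmod_map (b : Bmod U) : Bmod U' := MkB (metab_map_derived b).

Definition dual_map (Phi : Bmod U' -> k^o) : Bmod U -> k^o := Phi \o Bmod_map.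

End Functoriality.

(* Main.v *)
(* A morphism f : g_W -> g_W' induces a linear map P : U -> U' on the
   abelianizations, and f is the map induced by P plus terms of higher
   degree. An element b of W^\perp of degree d is killed by f, so P_* b plus
   terms of degree > d lies in W'^\perp; these terms are invisible to W'_d,
   hence P^* W'_d vanishes on W^\perp and, W being finite-dimensional, lies
   in W. The inverse of f gives the other inclusion. Conversely, since W' is
   generated by W'_d and P_* is semilinear over Sym(U) -> Sym(U'), the
   equality P^* W'_d = W_d makes P_* map W^\perp onto W'^\perp. *)

Require Import Defs.
From mathcomp Require Import all_boot all_algebra.
From mathcomp Require Import boolp classical_sets functions.
From HB Require Import structures.
From mathcomp Require Import mpoly.

Set Implicit Arguments.
Unset Strict Implicit.
Unset Printing Implicit Defensive.

Import GRing.Theory.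
Local Open Scope ring_scope.
Local Open Scope classical_set_scope.

(** * Linear algebra of forms and spans *)

Section LinearMaps.
Variables (k : fieldType) (V V' : lmodType k) (f : V -> V').
Hypothesis lf : linear f.

Lemma linear_fun0 : f 0 = 0.
Proof. by have := lf (-1) 0 0; rewrite !scaleN1r oppr0 addr0 addNr. Qed.

Lemma linear_funD x y : f (x + y) = f x + f y.
Proof. by have := lf 1 x y; rewrite !scale1r. Qed.

Lemma linear_funZ a x : f (a *: x) = a *: f x.
Proof. by have := lf a x 0; rewrite linear_fun0 !addr0. Qed.

Lemma linear_funB x y : f (x - y) = f x - f y.
Proof. by rewrite linear_funD -scaleN1r linear_funZ scaleN1r. Qed.

Lemma linear_fun_kernel_subspace : subspace [set x | f x = 0].
Proof.
split=> [|a x y /= fx fy] /=; first exact: linear_fun0.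
by rewrite lf fx fy scaler0 addr0.
Qed.

End LinearMaps.

Section Subspaces.
Variables (k : fieldType) (V : lmodType k).
Implicit Types S T : set V.

Lemma subspaceD S x y : subspace S -> S x -> S y -> S (x + y).
Proof. by move=> [_ SP] Sx Sy; rewrite -[x]scale1r; apply: SP. Qed.

Lemma subspaceZ S a x : subspace S -> S x -> S (a *: x).
Proof. by move=> [S0 SP] Sx; rewrite -[_ *: _]addr0; apply: SP. Qed.

Lemma lspan_mono S T : S `<=` T -> lspan S `<=` lspan T.
Proof.
by move=> ST; apply: (lspan_min (lspan_subspace T)) => x /ST; exact: lspan_sub.
Qed.

End Subspaces.

(** Induction on [s], removing the head form [Phi]. If [Phi] vanishes on the common kernel of the
    tail, the tail alone suffices; otherwise a vector [v] of that kernel with [Phi v] nonzero shows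
    which multiple of [Phi] to subtract from [Psi]. *)
Lemma lspan_double_annihilator (k : fieldType) (V : lmodType k)
    (s : seq (V -> k^o)) (Psi : V -> k^o) :
  (forall Phi, Phi \in s -> linear Phi) -> linear Psi ->
  (forall v, (forall Phi, Phi \in s -> Phi v = 0) -> Psi v = 0) ->
  lspan [set Phi | Phi \in s] Psi.
Proof.
elim: s Psi => [|Phi s IHs] Psi lin_s lPsi kerPsi.
  have -> : Psi = 0 by apply/funext => v; exact: kerPsi.
  by case: (lspan_subspace [set Phi : V -> k^o | Phi \in [::]]).
have lPhi : linear Phi by apply: lin_s; rewrite mem_head.
have lin_s' Xi : Xi \in s -> linear Xi.
  by move=> sXi; apply: lin_s; rewrite inE sXi orbT.
have sub_s : lspan [set Xi | Xi \in s] `<=` lspan [set Xi | Xi \in Phi :: s].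
  by apply: lspan_mono => Xi /= sXi; rewrite inE sXi orbT.
have [[v [sv Phiv]]|noV] := pselect (exists v, (forall Xi, Xi \in s -> Xi v = 0)
    /\ Phi v != 0); last first.
  apply/sub_s/IHs => // v sv; apply: kerPsi => Xi; rewrite inE.
  case/orP=> [/eqP -> | /sv //]; apply/eqP/negP => /negP Phiv.
  by apply: noV; exists v.
(* This choice makes [Psi - a *: Phi] vanish at [v]. *)
pose a := Psi v / Phi v.
have -> : Psi = (Psi - a *: Phi) + a *: Phi by rewrite subrK.
apply: subspaceD; first exact: lspan_subspace; last first.
  apply: subspaceZ; first exact: lspan_subspace.
  by apply: lspan_sub; rewrite /= mem_head.
have lPsi' : linear (Psi - a *: Phi).
  move=> b x y; rewrite !fctE /= lPsi lPhi !scalerDr !scalerN.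
  by rewrite opprD addrACA !scalerA mulrC.
apply/sub_s/IHs => // x sx.
(* Moving [x] along [v] brings it into the kernel of [Phi] without leaving the common kernel of the
   tail. *)
have: Psi (x - (Phi x / Phi v) *: v) = 0.
  apply: kerPsi => Xi; rewrite inE => /orP[/eqP ->|sXi].
    rewrite (linear_funB lPhi) (linear_funZ lPhi).
    by rewrite [_ *: _]mulfVK // subrr.
  have lXi := lin_s' _ sXi; rewrite (linear_funB lXi) (linear_funZ lXi).
  by rewrite (sx _ sXi) (sv _ sXi) [_ *: _]mulr0 subr0.
rewrite (linear_funB lPsi) (linear_funZ lPsi) => /eqP; rewrite subr_eq0 => /eqP PsiE.
rewrite !fctE PsiE /a; apply/eqP; rewrite subr_eq0; apply/eqP.
by rewrite [LHS]mulrAC [RHS]mulrAC [Phi x * _]mulrC.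
Qed.

(** * Lie morphisms, quotients and abelian Lie algebras *)

Section QuotientLift.
Variables (k : fieldType) (L L' : lieAlgType k) (I : lieIdeal L).
Variable f : L -> L'.
Hypotheses (mf : lie_morphism f) (fI : forall x, I x -> f x = 0).

Definition lquot_lift (x : lquot I) : L' := f (lrepr I x).

Lemma lquot_lift_pi x : lquot_lift (lpi I x) = f x.
Proof.
apply/eqP; rewrite -subr_eq0 -(linear_funB mf.1); apply/eqP/fI.
exact: lrepr_lpi.
Qed.

Lemma lquot_lift_morphism : lie_morphism lquot_lift.
Proof.
split=> [a x y|x y]; rewrite -[x]lreprK -[y]lreprK.
  by rewrite -linearP !lquot_lift_pi mf.1.
by rewrite -lpi_lbr !lquot_lift_pi mf.2.
Qed.

End QuotientLift.

Lemma lie_morphism_comp (k : fieldType) (L1 L2 L3 : lieAlgType k)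
    (g : L2 -> L3) (f : L1 -> L2) :
  lie_morphism g -> lie_morphism f -> lie_morphism (g \o f).
Proof.
by move=> [gl gb] [fl fb]; split=> [a x y|x y] /=; rewrite ?fl ?fb ?gl ?gb.
Qed.

Lemma lpi_morphism (k : fieldType) (L : lieAlgType k) (I : lieIdeal L) :
  lie_morphism (lpi I).
Proof. by split; [exact: lpi_linear | exact: lpi_lbr]. Qed.

(** A synonym of [V], so that the zero bracket is declared on it and not on [V] itself. *)
Definition abelian_lie (k : fieldType) (V : lmodType k) : Type := V.

Section AbelianLie.
Variables (k : fieldType) (V : lmodType k).

HB.instance Definition _ := GRing.Lmodule.on (abelian_lie V).

Let zero_lbr (x y : abelian_lie V) : abelian_lie V := 0.

Fact zero_lbr_linearl (a : k) x y z :
  zero_lbr (a *: x + y) z = a *: zero_lbr x z + zero_lbr y z.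
Proof. by rewrite /zero_lbr scaler0 addr0. Qed.
Fact zero_lbr_linearr (a : k) x y z :
  zero_lbr x (a *: y + z) = a *: zero_lbr x y + zero_lbr x z.
Proof. by rewrite /zero_lbr scaler0 addr0. Qed.
Fact zero_lbrxx x : zero_lbr x x = 0.
Proof. by []. Qed.
Fact zero_lbr_jacobi x y z :
  zero_lbr x (zero_lbr y z) + zero_lbr y (zero_lbr z x)
    + zero_lbr z (zero_lbr x y) = 0.
Proof. by rewrite /zero_lbr !addr0. Qed.
HB.instance Definition _ := isLieAlgebra.Build k (abelian_lie V)
  zero_lbr_linearl zero_lbr_linearr zero_lbrxx zero_lbr_jacobi.

Lemma morphism_abelian_derived (L : lieAlgType k) (f : L -> abelian_lie V) x :
  lie_morphism f -> derived L x -> f x = 0.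
Proof.
move=> [fl fb]; apply: (lspan_min (linear_fun_kernel_subspace fl)).
by move=> _ [y [z [_ _ ->]]] /=; rewrite fb.
Qed.

End AbelianLie.

(** * Projections of M(U) and g_W onto U *)

Section Abelianization.
Variables (k : fieldType) (U : vectType k).

Let id_linear : linear (id : U -> abelian_lie U).
Proof. by []. Qed.

Let fab : freeLie U -> abelian_lie U :=
  freeLie_lift (id : U -> abelian_lie U).
Let fab_morphism : lie_morphism fab := freeLie_lift_morphism id_linear.

(** The projection onto U along M(U)': the identity of U extends to Lie(U) and, its target being
    abelian, kills Lie(U)''. *)
Definition metab_ab : metab U -> abelian_lie U :=
  @lquot_lift _ _ _ (derived2_ideal (freeLie U)) fab.

Lemma derived2_derived (L : lieAlgType k) x : derived2 L x -> derived L x.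
Proof.
apply: (lspan_min (lspan_subspace _)) => _ [y [z [_ _ ->]]].
exact: derived_lbr.
Qed.

Let fab_derived2 x : derived2_ideal (freeLie U) x -> fab x = 0.
Proof.
by move=> /derived2_derived; apply: morphism_abelian_derived.
Qed.

Lemma metab_ab_morphism : lie_morphism metab_ab.
Proof. exact: lquot_lift_morphism fab_morphism fab_derived2. Qed.

Lemma metab_ab_gen u : metab_ab (Mgen u) = u.
Proof.
rewrite /metab_ab [LHS](lquot_lift_pi fab_morphism fab_derived2).
exact: freeLie_lift_gen id_linear u.
Qed.

Variable W : gsubmod U.

(** The projection descends because W^\perp lies in M(U)'. It identifies U with the abelianization
    of g_W. *)
Definition lie_of_ab : lie_of W -> abelian_lie U :=
  @lquot_lift _ _ _ (annih_ideal W) metab_ab.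

Let metab_ab_annih x : annih_ideal W x -> metab_ab x = 0.
Proof.
move=> [b _ <-]; apply: (morphism_abelian_derived metab_ab_morphism).
exact/in_derivedP/BvalP.
Qed.

Lemma lie_of_ab_morphism : lie_morphism lie_of_ab.
Proof. exact: lquot_lift_morphism metab_ab_morphism metab_ab_annih. Qed.

Definition lie_of_gen (u : U) : lie_of W := lpi (annih_ideal W) (Mgen u).

Lemma lie_of_ab_gen u : lie_of_ab (lie_of_gen u) = u.
Proof.
rewrite /lie_of_ab [LHS](lquot_lift_pi metab_ab_morphism metab_ab_annih).
exact: metab_ab_gen.
Qed.

Lemma lie_of_gen_linear : linear lie_of_gen.
Proof. by move=> a u v; rewrite /lie_of_gen !linearP. Qed.

Lemma lie_of_ab_derived x : derived (lie_of W) x -> lie_of_ab x = 0.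
Proof. exact: (morphism_abelian_derived lie_of_ab_morphism). Qed.

Lemma lie_of_ab_decomp (x : lie_of W) : exists b : Bmod U,
  x = lpi (annih_ideal W) (Mgen (lie_of_ab x : U) + Bval b).
Proof.
have [u [b E]] := metab_decomp (lrepr (annih_ideal W) x).
exists b; rewrite -{1}[x]lreprK E; congr (lpi _ (_ + _)).
rewrite /lie_of_ab /lquot_lift E (linear_funD metab_ab_morphism.1).
rewrite metab_ab_gen (morphism_abelian_derived metab_ab_morphism) ?addr0 //.
exact/in_derivedP/BvalP.
Qed.

End Abelianization.

(** * Degree filtrations of M(U) and B(U) *)

Section Grading.
Variables (k : fieldType) (U : vectType k).

Lemma lspan_lbr (L : lieAlgType k) (S T C : set L) x y :
  subspace C -> (forall x y, S x -> T y -> C [lie x, y]) ->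
  lspan S x -> lspan T y -> C [lie x, y].
Proof.
move=> sC STC Sx; have [C0 CP] := sC; move: y.
apply: (@lspan_min _ _ _ [set y | C [lie x, y]]).
  split=> [|a y z Cy Cz] /=; first by rewrite lbr0r.
  by rewrite lbr_linearr; apply: CP.
move=> y Ty /=; move: x Sx; apply: (@lspan_min _ _ _ [set x | C [lie x, y]]).
  split=> [|a u v Cu Cv] /=; first by rewrite lbr0l.
  by rewrite lbr_linearl; apply: CP.
by move=> x Sx; exact: STC.
Qed.

Lemma Mpi_surj (x : metab U) : exists y, x = Mpi y.
Proof. by exists (lrepr _ x); rewrite [RHS]lreprK. Qed.

Lemma Mpi_morphism : lie_morphism (@Mpi k U).
Proof. exact: lpi_morphism. Qed.

Lemma Mdeg_subspace n : subspace (Mdeg U n).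
Proof.
have sF : subspace (freeLie_deg (U := U) n) by exact: lspan_subspace.
split; first by exists 0; [case: sF | rewrite linear0].
move=> a _ _ [x xn <-] [y yn <-]; exists (a *: x + y); last by rewrite linearP.
by case: sF => _; apply.
Qed.

Lemma Mdeg_gen u : Mdeg U 1 (Mgen u).
Proof. by exists (fgen u) => //; apply: lspan_sub; exact: lie_mono_gen. Qed.

Lemma Mdeg_lbr m n x y :
  Mdeg U m x -> Mdeg U n y -> Mdeg U (m + n) [lie x, y].
Proof.
move=> [x0 xm <-] [y0 yn <-]; rewrite -Mpi_lbr; exists [lie x0, y0] => //.
apply: lspan_lbr xm yn; first exact: lspan_subspace.
by move=> z t zm tn; apply: lspan_sub; exact: lie_mono_lbr.
Qed.

(** The filtration by order, modulo which a morphism of the quotients is later compared with its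
    linear part. *)
Definition Mge n : set (metab U) :=
  lspan [set x | exists2 m, (n <= m)%N & Mdeg U m x].

Lemma Mge_subspace n : subspace (Mge n).
Proof. exact: lspan_subspace. Qed.

Lemma Mdeg_Mge n x : Mdeg U n x -> Mge n x.
Proof. by move=> xn; apply: lspan_sub; exists n. Qed.

Lemma Mge_le m n : (m <= n)%N -> Mge n `<=` Mge m.
Proof.
move=> mn; apply: lspan_mono => x [p np xp]; exists p => //.
exact: leq_trans np.
Qed.

Lemma Mge_lbr m n x y : Mge m x -> Mge n y -> Mge (m + n) [lie x, y].
Proof.
apply: lspan_lbr; first exact: Mge_subspace.
move=> u v [p mp up] [q nq vq]; apply: lspan_sub; exists (p + q)%N.
  exact: leq_add.
exact: Mdeg_lbr.
Qed.

Lemma Mge1 x : Mge 1 x.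
Proof.
have [y ->] := Mpi_surj x.
elim/freeLie_ind: y => [u||y z yP zP|a y yP|y z yP zP].
- exact/Mdeg_Mge/Mdeg_gen.
- by rewrite linear0; case: (Mge_subspace 1).
- by rewrite linearD; apply: subspaceD => //; exact: Mge_subspace.
- by rewrite linearZ; apply: subspaceZ => //; exact: Mge_subspace.
- by rewrite Mpi_lbr; apply: (@Mge_le 1 2) => //; exact: (@Mge_lbr 1 1).
Qed.

Lemma derived_Mge2 x : derived (metab U) x -> Mge 2 x.
Proof.
move: x; apply: (lspan_min (Mge_subspace 2)) => _ [y [z [_ _ ->]]].
by apply: (@Mge_lbr 1 1); exact: Mge1.
Qed.

Lemma Mdeg_derived n x : (1 < n)%N -> Mdeg U n x -> derived (metab U) x.
Proof.
move=> n1 [y yn <-]; apply: (derived_morphism Mpi_morphism).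
move: y yn; apply: (lspan_min (lspan_subspace _)) => z zn.
(* A generator has degree 1 and is excluded, so the monomial is a bracket. *)
case: zn n1 => [u|p q u v _ _] // _.
exact: derived_lbr.
Qed.

Definition Bge n : set (Bmod U) :=
  lspan [set b | exists2 m, (n <= m)%N & Bdeg U m b].

(* Directness of the grading of B(U) is
   never needed, since forms in B(U)_d^* vanish on this span by definition. *)
Definition Boff d : set (Bmod U) :=
  lspan [set b | exists2 m, m != d & Bdeg U m b].

(** From degree 2 on, homogeneous elements are combinations of brackets and so come from B(U), whose
    internal degree is smaller by two. *)
Lemma Mge_Bge n x : Mge (n + 2) x -> exists2 b, Bval b = x & Bge n b.
Proof.
move: x; apply: (@lspan_min _ _ _ [set x | exists2 b, Bval b = x & Bge n b]).
  have [B0 BP] : subspace (Bge n) by exact: lspan_subspace.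
  split=> [|a _ _ [b <- bn] [c <- cn]]; first by exists 0.
  by exists (a *: b + c); [| exact: BP].
move=> x [m nm xm].
have m1 : (1 < m)%N by apply: leq_trans nm; rewrite addn2.
have /in_derivedP dx := Mdeg_derived m1 xm.
exists (MkB dx) => //; apply: lspan_sub; exists (m - 2)%N.
  by rewrite leq_subRL // addnC.
by rewrite /Bdeg /= subnK.
Qed.

Lemma Bge_Boff d : Bge d.+1 `<=` Boff d.
Proof.
by apply: lspan_mono => b [m dm bm]; exists m => //; rewrite gtn_eqF.
Qed.

(** Used to evaluate forms concentrated in degree [d], which see only the summand [c]. *)
Lemma Bmod_decomp d (b : Bmod U) :
  exists c e, [/\ b = c + e, Bdeg U d c & Boff d e].
Proof.
(* All of M(U)' has order at least 2, so [b] is a sum of homogeneous elements of B(U). *)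
have [|c /val_inj -> ] := @Mge_Bge 0 (Bval b).
  exact/derived_Mge2/in_derivedP/BvalP.
have [O0 OP] : subspace (Boff d) by exact: lspan_subspace.
have [M0 MP] := Mdeg_subspace (d + 2).
apply: (@lspan_min _ _ _
  [set b | exists c e, [/\ b = c + e, Bdeg U d c & Boff d e]]).
  split=> [|a _ _ [x [y [-> xd yd]]] [z [t [-> zd td]]]] /=.
    by exists 0, 0; split; [rewrite addr0 | exact: M0 | exact: O0].
  exists (a *: x + z), (a *: y + t); split.
  - by rewrite scalerDr addrACA.
  - exact: MP.
  - exact: OP.
move=> x [m _ xm]; have [md|md] := eqVneq m d.
  by exists x, 0; split; [rewrite addr0 | rewrite -md | exact: O0].
exists 0, x; split; [by rewrite add0r | exact: M0 |].
by apply: lspan_sub; exists m.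
Qed.

Lemma Z2deg_Boff d Phi b : Z2deg U d Phi -> Boff d b -> Phi b = 0.
Proof.
move=> [[lPhi _] Phi0]; move: b.
apply: (lspan_min (linear_fun_kernel_subspace lPhi)) => b [m md bm] /=.
exact: Phi0 bm.
Qed.

Lemma gsub_linear (W : gsubmod U) Phi : W Phi -> linear Phi.
Proof. by move=> /gsub_Z2[]. Qed.

(** W^\perp is graded because W is: among the homogeneous components of a form of W, those of degree
    other than [d] kill [c], while the one of degree [d] kills [c + e] and [e]. *)
Lemma annih_component (W : gsubmod U) d c e :
  annih W (c + e) -> Bdeg U d c -> Boff d e -> annih W c.
Proof.
move=> Wce cd eo Phi /gsub_graded[N [Psi [PsiW ->]]].
rewrite fct_sumE; apply: big1 => r _.
have [rW rZ] := PsiW r; have [rd|rd] := eqVneq d r; last first.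
  by case: rZ => _; apply; [exact: rd | exact: cd].
have := Wce _ rW; rewrite (linear_funD (gsub_linear rW)).
by rewrite [X in _ + X](@Z2deg_Boff d) ?addr0 // rd.
Qed.

(** The action of [u] is that of the polynomial [sym_lin u], and contraction by it preserves W. *)
Lemma annih_adB (W : gsubmod U) u b : annih W b -> annih W (adB u b).
Proof.
move=> Wb Phi WPhi; rewrite -sym_act_lin; apply: (Wb (contract _ _)).
exact: gsub_contract.
Qed.

Lemma annih_Bmod_subspace (W : gsubmod U) : subspace (annih W).
Proof.
split=> [|a b c Wb Wc] Phi WPhi; first exact/linear_fun0/gsub_linear/WPhi.
by rewrite (gsub_linear WPhi) Wb // Wc // scaler0 addr0.
Qed.

End Grading.

(** * Maps induced on M(U), B(U) and forms by a linear map P *)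

Section MetabMap.
Variables (k : fieldType) (U U' : vectType k) (P : {linear U -> U'}).

Lemma metab_map_deg n x : Mdeg U n x -> Mdeg U' n (metab_map P x).
Proof.
move=> [y yn <-]; rewrite metab_map_pi; exists (freeLie_map P y) => //.
have [fl fb] := freeLie_map_morphism P.
move: y yn; apply: (linear_sub_span fl (lspan_subspace _)) => y ym.
apply: lspan_sub; elim: ym => [u|p q z t _ IHz _ IHt].
  rewrite /freeLie_map freeLie_lift_gen; first exact: lie_mono_gen.
  by move=> a v w /=; rewrite !linearP.
by rewrite fb; exact: lie_mono_lbr.
Qed.

Lemma Bmod_map_linear : linear (Bmod_map P).
Proof.
by move=> a b c; apply: val_inj; rewrite /= (metab_map_morphism P).1.
Qed.

Lemma Bmod_map_deg n b : Bdeg U n b -> Bdeg U' n (Bmod_map P b).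
Proof. exact: metab_map_deg. Qed.

Lemma Bmod_map_off d b : Boff d b -> Boff d (Bmod_map P b).
Proof.
move: b; apply: (linear_sub_span Bmod_map_linear (lspan_subspace _)).
by move=> b [m md bm]; apply: lspan_sub; exists m => //; exact: Bmod_map_deg.
Qed.

Lemma dual_map_linear Phi : linear Phi -> linear (dual_map P Phi).
Proof. by move=> lPhi a b c; rewrite /dual_map /= Bmod_map_linear lPhi. Qed.

Lemma dual_map_Z2deg d Phi : Z2deg U' d Phi -> Z2deg U d (dual_map P Phi).
Proof.
move=> [[lPhi [N PhiN]] Phid]; split; last first.
  by move=> s b sd bs; apply: (Phid s) => //; exact: Bmod_map_deg.
split; first exact: dual_map_linear.
by exists N => r b Nr br; apply: (PhiN r) => //; exact: Bmod_map_deg.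
Qed.

(** Semilinearity of P_* over Sym(U) -> Sym(U'), for a single vector. *)
Lemma Bmod_map_adB u b :
  Bmod_map P (adB u b) = adB (P u) (Bmod_map P b).
Proof.
by apply: val_inj; rewrite /= (metab_map_morphism P).2 metab_map_gen.
Qed.

Variable Q : {linear U' -> U}.
Hypothesis PK : cancel P Q.

Lemma metab_map_cancel : cancel (metab_map P) (metab_map Q).
Proof.
have [Pl Pb] := metab_map_morphism P; have [Ql Qb] := metab_map_morphism Q.
move=> x; have [y ->] := Mpi_surj x.
elim/freeLie_ind: y => [u||y z yP zP|a y yP|y z yP zP].
- by rewrite -/(Mgen u) !metab_map_gen PK.
- by rewrite linear0 (linear_fun0 Pl) (linear_fun0 Ql).
- by rewrite linearD (linear_funD Pl) (linear_funD Ql) yP zP.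
- by rewrite linearZ (linear_funZ Pl) (linear_funZ Ql) yP.
- by rewrite Mpi_lbr Pb Qb yP zP.
Qed.

Lemma Bmod_map_cancel : cancel (Bmod_map P) (Bmod_map Q).
Proof. by move=> b; apply: val_inj; exact: metab_map_cancel. Qed.

End MetabMap.

(** * Leading part of a morphism g_W -> g_W' *)

Section LeadingPart.
Variables (k : fieldType) (U U' : vectType k).
Variables (W : gsubmod U) (W' : gsubmod U').
Variables (f : lie_of W -> lie_of W') (P : {linear U -> U'}).
Hypothesis mf : lie_morphism f.
Hypothesis P_lin : forall u, P u = lie_of_ab (f (lie_of_gen W u)).

Local Notation pW := (lpi (annih_ideal W)).
Local Notation pW' := (lpi (annih_ideal W')).

(** Induction on bracket monomials: each error term of a bracket contains the error of at least one
    factor, which raises its order by one. *)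
Lemma leading_part n x : Mdeg U n x ->
  exists2 h, Mge n.+1 h & f (pW x) = pW' (metab_map P x + h).
Proof.
have [fl fb] := mf; have [Pl Pb] := metab_map_morphism P.
move=> [y yn <-]; move: y yn; apply: (@lspan_min _ _ _ [set y |
    exists2 h, Mge n.+1 h & f (pW (Mpi y)) = pW' (metab_map P (Mpi y) + h)]).
  have [M0 MP] := @Mge_subspace _ U' n.+1.
  split=> [|a y z [h hn Ey] [g gn Ez]] /=.
    exists 0 => //; rewrite !linear0 (linear_fun0 fl) (linear_fun0 Pl) addr0.
    by rewrite linear0.
  exists (a *: h + g); first exact: MP.
  rewrite !linearP fl Ey Ez Pl -linearP scalerDr; congr (pW' _).
  by rewrite addrACA.
move=> y; elim=> {n y} [u|m n y z ym [h hm Ey] zn [g gn Ez]] /=.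
  (* On a generator the error lies in B(U'), hence has order at least 2. *)
  have [b E] := lie_of_ab_decomp (f (lie_of_gen W u)).
  exists (Bval b); first exact/derived_Mge2/in_derivedP/BvalP.
  by rewrite -/(Mgen u) metab_map_gen P_lin.
have yM : Mge m (metab_map P (Mpi y)).
  by apply/Mdeg_Mge/metab_map_deg; exists y => //; apply: lspan_sub.
have zM : Mge n (metab_map P (Mpi z)).
  by apply/Mdeg_Mge/metab_map_deg; exists z => //; apply: lspan_sub.
set y' := metab_map P (Mpi y) in Ey yM *.
set z' := metab_map P (Mpi z) in Ez zM *.
(* These are the terms of [[lie y' + h, z' + g]] other than [[lie y', z']]; their orders are at
   least [m + n.+1] and [m.+1 + n]. *)
exists ([lie y', g] + [lie h, z' + g]).
  apply: subspaceD; first exact: Mge_subspace.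
    by rewrite -addnS; exact: Mge_lbr.
  rewrite -addSn; apply: Mge_lbr => //.
  apply: subspaceD => //; first exact: Mge_subspace.
  by apply: Mge_le gn.
rewrite Mpi_lbr lpi_lbr fb Ey Ez -lpi_lbr Pb -/y' -/z' lbrDl lbrDr.
by rewrite addrA.
Qed.

(** As W is spanned by finitely many forms, a linear form belongs to it once it vanishes on W^\perp.
    Both W^\perp and the form are graded, so vanishing is tested in degree [d]. *)
Lemma dual_map_top d Phi : gsub_findim W ->
  gsub_deg W' d Phi -> gsub_deg W d (dual_map P Phi).
Proof.
move=> [s Ws] [WPhi Phid]; split; last exact: dual_map_Z2deg.
have lPhi := gsub_linear WPhi.
rewrite Ws; apply: lspan_double_annihilator.
- move=> Psi sPsi; apply: (@gsub_linear _ _ W); rewrite Ws.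
  exact: lspan_sub.
- exact: dual_map_linear.
move=> b sb; have Wb : annih W b.
  move=> Psi; rewrite Ws => -[t [tP ->]].
  rewrite fct_sumE big_seq big1 // => p /tP /= /sb sp.
  by rewrite fctE sp [LHS]mulr0.
have [c [e [E cd eo]]] := Bmod_decomp d b; rewrite E in Wb *.
rewrite (linear_funD (dual_map_linear P lPhi)).
rewrite [X in _ + X](Z2deg_Boff Phid) ?addr0; last exact: Bmod_map_off.
have Wc := annih_component Wb cd eo.
(* Internal degree [d] is degree [d + 2] in M(U), so the error has order at least [d.+1 + 2], that
   is, internal order at least [d.+1]. *)
have [h] := leading_part cd; rewrite -addSn => /Mge_Bge[h' <- hd].
have -> : pW (Bval c) = 0.
  rewrite -(linear0 pW); apply/lpi_eq; rewrite subr0.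
  by exists c.
(* Since [f] kills the class of [c], its leading part plus the error lies in W'^\perp; [Phi] does
   not see the error. *)
rewrite (linear_fun0 mf.1) -(linear0 pW') => /esym/lpi_eq; rewrite subr0.
move=> [a Wa aE].
have Ea : a = Bmod_map P c + h' by apply: val_inj.
have := Wa _ WPhi; rewrite Ea (linear_funD lPhi).
by rewrite [X in _ + X](Z2deg_Boff Phid) ?addr0 //; exact: Bge_Boff.
Qed.

End LeadingPart.

(** * The linear map between abelianizations *)

Section LinearPart.
Variables (k : fieldType) (U U' : vectType k).
Variables (W : gsubmod U) (W' : gsubmod U').

Lemma linear_part_ex (f : lie_of W -> lie_of W') : lie_morphism f ->
  exists P : {linear U -> U'},
    forall u, P u = lie_of_ab (f (lie_of_gen W u)).
Proof.
move=> [fl _]; pose p u : U' := lie_of_ab (f (lie_of_gen W u)).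
have lp : linear p.
  move=> a u v; rewrite /p lie_of_gen_linear fl.
  exact: (lie_of_ab_morphism W').1.
pose lpB := GRing.isLinear.Build k U U' *:%R p lp.
pose P : {linear U -> U'} := HB.pack p lpB.
by exists P.
Qed.

(** The image [f u] differs from the generator [P u] by a derived element, which [g] keeps derived
    and the projection to U kills. *)
Lemma linear_part_cancel (f : lie_of W -> lie_of W') (g : lie_of W' -> lie_of W)
    (P : {linear U -> U'}) (Q : {linear U' -> U}) :
  lie_morphism g -> cancel f g ->
  (forall u, P u = lie_of_ab (f (lie_of_gen W u))) ->
  (forall u, Q u = lie_of_ab (g (lie_of_gen W' u))) -> cancel P Q.
Proof.
move=> mg fK PE QE u; have [b E] := lie_of_ab_decomp (f (lie_of_gen W u)).
rewrite QE PE -[RHS](lie_of_ab_gen W) -[in RHS](fK (lie_of_gen W u)) [in RHS]E.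
rewrite linearD (linear_funD mg.1) (linear_funD (lie_of_ab_morphism W).1).
rewrite [X in _ = _ + X]lie_of_ab_derived ?addr0 //.
apply: (derived_morphism mg); apply: (derived_morphism (lpi_morphism _)).
exact/in_derivedP/BvalP.
Qed.

End LinearPart.

(** * The morphism g_W -> g_W' induced by a linear isomorphism *)

Section InducedMorphism.
Variables (k : fieldType) (U U' : vectType k).
Variables (W : gsubmod U) (W' : gsubmod U') (d : nat).
Variables (P : {linear U -> U'}) (Q : {linear U' -> U}).
Hypotheses (QK : cancel Q P) (lW' : level W' d).
Hypothesis PW : forall Phi, gsub_deg W' d Phi -> gsub_deg W d (dual_map P Phi).

(** The image of W^\perp under P_* is stable under Sym(U'): a vector u' acts on [Bmod_map P c] as
    P_* of the action of [Q u'] on [c]. Working one vector at a time avoids comparing polynomials in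
    the bases of U and U'. *)
Lemma annih_sym_act p b : annih W b ->
  exists2 c, annih W c & sym_act p (Bmod_map P b) = Bmod_map P c.
Proof.
have Pl := Bmod_map_linear P; have [A0 AP] := annih_Bmod_subspace W.
have ad_ex u c : annih W c ->
    exists2 e, annih W e & adB u (Bmod_map P c) = Bmod_map P e.
  move=> Wc; exists (adB (Q u) c); first exact: annih_adB.
  by rewrite Bmod_map_adB QK.
move=> Wb; rewrite /sym_act; elim/big_rec: _ => [|m _ _ [c Wc ->]].
  by exists 0; rewrite ?(linear_fun0 Pl).
suff [e We ->] : exists2 e, annih W e & mon_act m (Bmod_map P b) = Bmod_map P e.
  by exists (p@_m *: e + c); [exact: AP | rewrite Pl].
rewrite /mon_act; elim: (enum _) => /= [|i s [e We ->]]; first by exists b.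
elim: (m i) => /= [|j [a Wa ->]]; first by exists e.
exact: ad_ex.
Qed.

(** By levelness it suffices to test contractions of forms [Psi] in W'_d. Moving the polynomial onto
    [Bmod_map P b] gives some [Bmod_map P c] with [c] in W^\perp, and the pullback of [Psi] lies in
    W. *)
Lemma Bmod_map_annih b : annih W b -> annih W' (Bmod_map P b).
Proof.
case: lW' => _ _ W'E Wb Phi; rewrite W'E => -[s [sP ->]].
rewrite fct_sumE big_seq big1 // => q /sP[p [Psi [PsiW qE]]].
have [c Wc E] := annih_sym_act p Wb.
by rewrite fctE qE /contract E [X in _ *: X](Wc _ (PW PsiW).1) [LHS]mulr0.
Qed.

Definition lie_of_map : lie_of W -> lie_of W' :=
  @lquot_lift _ _ _ (annih_ideal W) (lpi (annih_ideal W') \o metab_map P).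

Let comp_morphism : lie_morphism (lpi (annih_ideal W') \o metab_map P).
Proof.
exact: lie_morphism_comp (lpi_morphism _) (metab_map_morphism P).
Qed.

Let comp_annih x : annih_ideal W x ->
  (lpi (annih_ideal W') \o metab_map P) x = 0.
Proof.
move=> [b Wb <-]; rewrite /= -(linear0 (lpi (annih_ideal W'))).
by apply/lpi_eq; rewrite subr0; exists (Bmod_map P b) => //; exact: Bmod_map_annih.
Qed.

Lemma lie_of_map_pi x :
  lie_of_map (lpi (annih_ideal W) x) = lpi (annih_ideal W') (metab_map P x).
Proof. exact: lquot_lift_pi comp_morphism comp_annih x. Qed.

Lemma lie_of_map_morphism : lie_morphism lie_of_map.
Proof. exact: lquot_lift_morphism comp_morphism comp_annih. Qed.

Lemma lie_of_map_deg n x : lie_of_deg W n x -> lie_of_deg W' n (lie_of_map x).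
Proof.
move=> [y yn <-]; rewrite lie_of_map_pi; exists (metab_map P y) => //.
exact: metab_map_deg.
Qed.

End InducedMorphism.

(** * The two directions of the criterion *)

Section Criterion.
Variables (k : fieldType) (U U' : vectType k).
Variables (W : gsubmod U) (W' : gsubmod U') (d : nat).

(** The leading-part argument is applied to [f] and to its inverse, whose linear parts are mutually
    inverse; each gives one inclusion. *)
Lemma top_iso_of_lie_iso : gsub_findim W -> gsub_findim W' ->
  lie_isomorphic (lie_of W) (lie_of W') ->
  exists P : {linear U -> U'},
    bijective P /\ dual_map P @` gsub_deg W' d = gsub_deg W d.
Proof.
move=> fW fW' [f [mf [g fK gK]]].
have mg : lie_morphism g.
  split=> [a x y|x y]; apply: (can_inj fK); rewrite gK.
    by rewrite mf.1 !gK.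
  by rewrite mf.2 !gK.
have [P PE] := linear_part_ex mf; have [Q QE] := linear_part_ex mg.
have PK := linear_part_cancel mg fK PE QE.
have QK := linear_part_cancel mf gK QE PE.
exists P; split; first by exists Q.
apply/seteqP; split=> [_ [Phi WPhi <-]|Phi WPhi].
  exact: (dual_map_top mf PE).
exists (dual_map Q Phi); first exact: (dual_map_top mg QE).
by apply/funext => b; rewrite /dual_map /= (Bmod_map_cancel PK).
Qed.

Lemma graded_iso_of_top_iso : level W d -> level W' d ->
  (exists P : {linear U -> U'},
    bijective P /\ dual_map P @` gsub_deg W' d = gsub_deg W d) ->
  graded_lie_isomorphic (lie_of_deg W) (lie_of_deg W').
Proof.
move=> lW lW' [P [[q PK qK] PW]].
pose qB := GRing.isLinear.Build k U' U *:%R q (can2_linear PK qK).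
pose Q : {linear U' -> U} := HB.pack q qB.
have QK : cancel Q P by [].
have PQK : cancel P Q by [].
have WP Phi : gsub_deg W' d Phi -> gsub_deg W d (dual_map P Phi).
  by move=> WPhi; rewrite -PW; exists Phi.
(* Surjectivity of P^* onto W_d yields the hypothesis for the inverse [Q], since Q^* undoes P^*. *)
have WQ Phi : gsub_deg W d Phi -> gsub_deg W' d (dual_map Q Phi).
  rewrite -PW => -[Psi WPsi <-].
  suff -> : dual_map Q (dual_map P Psi) = Psi by [].
  by apply/funext => b; rewrite /dual_map /= (Bmod_map_cancel QK).
pose F := @lie_of_map k U U' W W' P; pose G := @lie_of_map k U' U W' W Q.
have FK : cancel F G.
  move=> x; rewrite -[x]lreprK /F (lie_of_map_pi QK lW' WP).
  by rewrite /G (lie_of_map_pi PQK lW WQ) (metab_map_cancel PQK).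
have GK : cancel G F.
  move=> x; rewrite -[x]lreprK /G (lie_of_map_pi PQK lW WQ).
  by rewrite /F (lie_of_map_pi QK lW' WP) (metab_map_cancel QK).
exists F; split; first exact: (lie_of_map_morphism QK lW' WP).
  by exists G.
move=> n; apply/seteqP; split=> [_ [x xn <-]|x xn].
  exact: (lie_of_map_deg QK lW' WP).
by exists (G x); [exact: (lie_of_map_deg PQK lW WQ) | exact: GK].
Qed.

End Criterion.

Theorem corollary3p5 (k : fieldType) (char0 : [pchar k] =i pred0)
    (U U' : vectType k) (W : gsubmod U) (W' : gsubmod U') (d : nat)
    (W_findim : gsub_findim W) (W'_findim : gsub_findim W')
    (W_level : level W d) (W'_level : level W' d) :
  (lie_isomorphic (lie_of W) (lie_of W') <->
     exists P : {linear U -> U'},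
       bijective P /\ dual_map P @` gsub_deg W' d = gsub_deg W d) /\
  (graded_lie_isomorphic (lie_of_deg W) (lie_of_deg W') <->
     exists P : {linear U -> U'},
       bijective P /\ dual_map P @` gsub_deg W' d = gsub_deg W d).
Proof.
(* Forgetting the grading closes the cycle of implications: abstract isomorphism, linear isomorphism
   of top parts, graded isomorphism. *)
have iso_of_graded : graded_lie_isomorphic (lie_of_deg W) (lie_of_deg W') ->
    lie_isomorphic (lie_of W) (lie_of W') by move=> [f [mf bf _]]; exists f.
have fwd := top_iso_of_lie_iso d W_findim W'_findim.
have bwd := graded_iso_of_top_iso W_level W'_level.
by split; split=> [|/bwd] // /iso_of_graded.
Qed.
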